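(* Let $R$ be a commutative ring with non-zero identity and $M$ a non-zero unital $R$-module. Every prime submodule of $M$ is a 1-absorbing prime submodule of $M$, and every 1-absorbing prime submodule of $M$ is a 2-absorbing submodule of $M$.
   Context: For a submodule $N$ of $M$, $(N:M)=\{r\in R: rM\subseteq N\}$. Let $N$ be a proper submodule of $M$. - $N$ is prime if for all $r\in R$, $m\in M$, $rm\in N$ implies $m\in N$ or $rM\subseteq N$. - $N$ is 1-absorbing prime if for all non-unit elements $a,b\in R$ and all $m\in M$, $abm\in N$ implies $ab\in(N:M)$ or $m\in N$. - $N$ is 2-absorbing if for all $a,b\in R$ and $m\in M$, $abm\in N$ implies $ab\in(N:M)$ or $am\in N$ or $bm\in N$. *)

(* Defs.v *)
From HB Require Import structures.
From mathcomp Require Import all_boot all_algebra.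
From mathcomp Require Import boolp classical_sets.

Set Implicit Arguments.
Unset Strict Implicit.
Unset Printing Implicit Defensive.

Import GRing.Theory.

Local Open Scope classical_set_scope.
Local Open Scope ring_scope.

(* GRing.unit is available only on rings with a boolean invertibility test;
   invertibility is a Prop here so that R is an arbitrary commutative ring. *)
Definition is_unit (R : comNzRingType) (a : R) : Prop := exists b : R, a * b = 1.

Section Submodules.
Variables (R : comNzRingType) (M : lmodType R).
Implicit Types N : set M.

Definition proper_submodule N : Prop := submod_closed [in N] /\ N <> [set: M].

(* (N : M) *)
Definition colon N : set R := [set r | [set r *: m | m in [set: M]] `<=` N].

Definition prime_submodule N : Prop :=
  proper_submodule N /\
  forall (r : R) (m : M),
    N (r *: m) -> N m \/ [set r *: x | x in [set: M]] `<=` N.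

Definition one_absorbing_prime_submodule N : Prop :=
  proper_submodule N /\
  forall (a b : R) (m : M), ~ is_unit a -> ~ is_unit b ->
    N ((a * b) *: m) -> colon N (a * b) \/ N m.

Definition two_absorbing_submodule N : Prop :=
  proper_submodule N /\
  forall (a b : R) (m : M),
    N ((a * b) *: m) -> [\/ colon N (a * b), N (a *: m) | N (b *: m)].

End Submodules.

(* Main.v *)
Require Import Defs.
From HB Require Import structures.
From mathcomp Require Import all_boot all_algebra.
From mathcomp Require Import boolp classical_sets.

Import GRing.Theory.

Local Open Scope classical_set_scope.
Local Open Scope ring_scope.

(** A prime submodule absorbs the product [a * b] as a single scalar. For the second implication,
    split on invertibility: a unit among [a], [b] can be cancelled from [(a * b) *: m]
    ([unit_cancel_submodule]), leaving the other multiple of [m] in [N]; if neither is a unit, the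
    1-absorbing condition applies directly. *)

Lemma proper_submoduleZ (R : comNzRingType) (M : lmodType R) (N : set M)
    (r : R) (m : M) :
  proper_submodule N -> N m -> N (r *: m).
Proof.
move=> [[N0 NL] _] /mem_set Nm.
by have := NL r m 0 Nm N0; rewrite addr0 => /set_mem.
Qed.

Lemma unit_cancel_submodule (R : comNzRingType) (M : lmodType R) (N : set M)
    (a : R) (m : M) :
  proper_submodule N -> is_unit a -> N (a *: m) -> N m.
Proof.
move=> hN [c ac1] /(proper_submoduleZ _ _ _ c _ hN).
by rewrite scalerA mulrC ac1 scale1r.
Qed.

Theorem proposition1 (R : comNzRingType) (M : lmodType R)
    (M_nonzero : exists x : M, x <> 0) :
  (forall N : set M, prime_submodule N -> one_absorbing_prime_submodule N) /\
  (forall N : set M,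
     one_absorbing_prime_submodule N -> two_absorbing_submodule N).
Proof.
split=> N [hN absN]; split=> // a b m.
  (* Primeness is used with [r := a * b]; its second alternative unfolds to [colon N (a * b)]. *)
  by move=> _ _ /absN [Nm|Nab]; [right|left].
move=> Nabm.
have [ua|nua] := pselect (is_unit a).
  by apply: Or33; apply: (unit_cancel_submodule _ _ _ _ _ hN ua); rewrite scalerA.
have [ub|nub] := pselect (is_unit b).
  apply: Or32; apply: (unit_cancel_submodule _ _ _ _ _ hN ub).
  by rewrite scalerA mulrC.
have [Nab|Nm] := absN a b m nua nub Nabm; first exact: Or31.
(* Here [m] itself lies in [N], hence so does [a *: m]. *)
by apply: Or32; exact: proper_submoduleZ.
Qed.
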